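(* Let $X$ be a Tychonoff space and let $\mathscr{B}$ be a bornology on $X$ with a closed base $\mathscr{S}$. Then the topology $\mathscr{T}_{\mathscr{B}}$ on $C(X)$ is metrizable if and only if the space $(C(X),\mathscr{T}_{\mathscr{B}})$ has at least one $q_D$-point for some dense subset $D\subseteq C(X)$.
   Context: A bornology $\mathscr{B}$ on a nonempty set $X$ is a family of nonempty subsets of $X$ that covers $X$ and is closed under taking finite unions and under taking (nonempty) subsets. A subfamily $\mathscr{S}\subseteq\mathscr{B}$ is a base of $\mathscr{B}$ if each $B\in\mathscr{B}$ is contained in some $A\in\mathscr{S}$; it is a closed base if moreover every member of $\mathscr{S}$ is a closed subset of $X$. $C(X)$ is the set of continuous functions from $X$ to $\mathbb{R}$ (with the Euclidean metric). The topology $\mathscr{T}_{\mathscr{B}}$ of uniform convergence on $\mathscr{B}$ is the topology on $C(X)$ induced by the uniformity $\Delta_{\mathscr{B}}$ having as a base of entourages all sets $$[B;\varepsilon]=\{(f,g)\in C(X)\times C(X): |f(x)-g(x)|<\varepsilon \text{ for all } x\in B\},$$ where $B\in\mathscr{B}$ and $\varepsilon>0$. Let $D$ be a dense subset of a topological space $T$. A point $x\in T$ is a $q_D$-point of $T$ if there is a sequence $\langle U_n:n\ge1\rangle$ of open neighborhoods of $x$ such that every sequence $\langle x_n:n\ge1\rangle$ with $x_n\in U_n\cap D$ for all $n\ge1$ has a cluster point in $T$. In the claim, density of $D$ is with respect to $\mathscr{T}_{\mathscr{B}}$. *)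

(* Defs.v *)
From HB Require Import structures.
From mathcomp Require Import all_boot all_order all_algebra.
From mathcomp Require Import all_classical all_reals all_analysis.

Set Implicit Arguments.
Unset Strict Implicit.
Unset Printing Implicit Defensive.

Import Order.TTheory GRing.Theory Num.Theory.
Import numFieldNormedType.Exports.

Local Open Scope classical_set_scope.
Local Open Scope ring_scope.

Definition tychonoff_space (X : topologicalType) : Prop :=
  hausdorff_space X /\ completely_regular_space X.

(* The library's [completely_regular_space] is phrased with uniformities; this
   is the usual formulation with real-valued functions. *)
Lemma completely_regularP (R : realType) (X : topologicalType) :
  completely_regular_space X <->
  forall (a : X) (F : set X), closed F -> ~ F a ->
    exists f : X -> R, [/\ continuous f, range f `<=` `[0, 1],
      f a = 0 & forall y, F y -> f y = 1].
Proof.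
split=> [crX a F cF Fa|H a F cF Fa].
  have sep := crX a F cF Fa.
  exists (@Urysohn X R [set a] F); split.
  - exact: Urysohn_continuous.
  - exact: Urysohn_range.
  - by apply: (@Urysohn_sub0 X R _ _ sep); exists a.
  - by move=> y Fy; apply: (@Urysohn_sub1 X R _ _ sep); exists y.
have [f [cf rf fa fF]] := H a F cF Fa.
apply/(@uniform_separatorP X R); exists f; split => //.
- by move=> _ [_ -> <-].
- by move=> _ [y Fy <-]; exact: fF.
Qed.

(* The members of a bornology are nonempty, so closure under finite unions is
   closure under binary unions. *)
Record is_bornology (X : Type) (B : set (set X)) : Prop := IsBornology {
  bornology_carrier : [set: X] !=set0 ;
  bornology_nonempty : forall A, B A -> A !=set0 ;
  bornology_cover : \bigcup_(A in B) A = [set: X] ;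
  bornology_setU : forall A1 A2, B A1 -> B A2 -> B (A1 `|` A2) ;
  bornology_sub : forall A A', B A -> A' `<=` A -> A' !=set0 -> B A' }.

Record bornology (X : Type) := Bornology {
  bornology_sets :> set (set X) ;
  bornologyP : is_bornology bornology_sets }.

Definition bornology_base (X : Type) (B : bornology X) (S : set (set X)) :=
  S `<=` B /\ forall A, bornology_sets B A -> exists2 A', S A' & A `<=` A'.

Definition closed_bornology_base (X : topologicalType) (B : bornology X)
    (S : set (set X)) :=
  bornology_base B S /\ forall A, S A -> closed A.

Definition unif_box (X : topologicalType) (R : realType) (A : set X) (e : R) :
    set (continuousType X R * continuousType X R) :=
  [set fg : continuousType X R * continuousType X R |
    forall x, A x -> `|fg.1 x - fg.2 x| < e].

(* C(X); the argument B only serves to select the uniformity [Delta]. *)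
Definition Cfun (R : realType) (X : topologicalType) (B : bornology X) : Type :=
  continuousType X R.

Section uniformity.
Context (R : realType) (X : topologicalType) (B : bornology X).
Local Notation C := (Cfun R B).

Definition Delta : set_system (C * C) :=
  filter_from [set Ae : set X * R | bornology_sets B Ae.1 /\ 0 < Ae.2]
              (fun Ae => unif_box Ae.1 Ae.2).

Let Delta_filter : Filter Delta.
Proof.
apply: filter_from_filter.
  have [x _] := bornology_carrier (bornologyP B).
  have : [set: X] x by [].
  rewrite -(bornology_cover (bornologyP B)) => -[A BA _].
  by exists (A, 1).
move=> [A1 e1] [A2 e2] /= [BA1 e10] [BA2 e20].
exists (A1 `|` A2, Num.min e1 e2).
  split => /=; last by rewrite lt_min e10.
  exact: (bornology_setU (bornologyP B)).
move=> fg /= H; split=> x Ax /=.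
  by have := H x (or_introl Ax); rewrite lt_min => /andP[].
by have := H x (or_intror Ax); rewrite lt_min => /andP[].
Qed.

Local Open Scope relation_scope.

Let Delta_diagonal E : Delta E -> diagonal `<=` E.
Proof.
move=> [[A e] [BA e0] AE] [f g] /diagonalP <-.
by apply: AE => x _; rewrite subrr normr0.
Qed.

Let Delta_inv E : Delta E -> Delta E^-1.
Proof.
move=> [[A e] Ae AE]; exists (A, e) => // -[f g] fg.
by apply: AE => x Ax /=; rewrite distrC; exact: fg.
Qed.

Let Delta_split E : Delta E -> exists2 E', Delta E' & E' \; E' `<=` E.
Proof.
move=> [[A e] [/= BA e0] AE]; exists (unif_box A (e / 2)).
  by exists (A, e / 2) => //; split => //=; rewrite divr_gt0.
move=> [f g] [h fh hg]; apply: AE => x Ax /=.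
rewrite (le_lt_trans (ler_distD (h x) _ _))//.
by rewrite [ltRHS]splitr ltrD//; [exact: fh|exact: hg].
Qed.

HB.instance Definition _ := Choice.on C.
HB.instance Definition _ := @isUniform.Build C
  Delta Delta_filter Delta_diagonal Delta_inv Delta_split.

End uniformity.

Definition metrizable (R : realType) (T : topologicalType) : Prop :=
  exists d : T -> T -> R,
    [/\ forall x y, d x y = 0 <-> x = y,
        forall x y, d x y = d y x,
        forall x y z, d x z <= d x y + d y z &
        forall x (A : set T),
          nbhs x A <-> exists2 e, 0 < e & [set y | d x y < e] `<=` A].

Definition qD_point (T : topologicalType) (D : set T) (x : T) : Prop :=
  exists U : nat -> set T,
    (forall n, open_nbhs x (U n)) /\
    forall u : nat -> T, (forall n, (U n `&` D) (u n)) ->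
      exists p : T, cluster (u @ \oo) p.

(* Main.v *)
(* A metrizable space consists of q-points.  Conversely, let [f] be a q_D-point
   with neighborhoods [U n], and pick closed [E n] in the bornology, increasing,
   such that [U n] contains every function that agrees with [f] on [E n].  Then
   every [A] in the bornology lies in some [E n]: otherwise there are points [x n]
   of [A] outside [E n], and functions [g n] in [U n] and [D] that are close to
   [f] on [E n] and to [f + n] at [x n].  If [x n] can be chosen constant, then
   [g n (x n)] tends to infinity and [g] has no cluster point.  If not, [A] is
   contained in the union of the [E n], so a cluster point of [g] agrees with [f]
   on [A]; but it is also uniformly close on [A] to some [g n] with [n >= 2], a
   contradiction at [x n].  Once the bornology has a countable cofinal family
   [E n], the supremum of [min (1 / (n + 1)) |f x - g x|] over all [n] and all
   [x] in [E n] is a metric that induces the topology. *)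

Require Import Defs.
From HB Require Import structures.
From mathcomp Require Import all_boot all_order all_algebra.
From mathcomp Require Import all_classical all_reals all_analysis.
From mathcomp Require Import lra.

Import Order.TTheory GRing.Theory Num.Theory.
Import numFieldNormedType.Exports.

Local Open Scope classical_set_scope.

Local Open Scope ring_scope.

Section uniform_convergence.
Context {R : realType} {X : topologicalType} {B : bornology X}.
Implicit Types (f g h p : Cfun R B) (A E : set X).

Lemma bornology_set1 (x : X) : bornology_sets B [set x].
Proof.
have : [set: X] x by [].
rewrite -(bornology_cover (bornologyP B)) => -[A BA Ax].
apply: (bornology_sub (bornologyP B)) BA _ _; last by exists x.
by move=> _ ->.
Qed.

Lemma nbhs_CfunP f (W : set (Cfun R B)) :
  nbhs f W <-> exists A (e : R), [/\ bornology_sets B A, 0 < e &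
    forall g, (forall x, A x -> `|f x - g x| < e) -> W g].
Proof.
rewrite -nbhs_entourageE; split.
  move=> [V [[A e] [/= BA e0] AV] VW]; exists A, e; split => // g fg.
  by apply: VW; rewrite /xsection /= inE; exact: AV.
move=> [A [e [BA e0 AW]]]; exists (unif_box A e).
  by exists (A, e).
by move=> g; rewrite /xsection /= inE => /AW.
Qed.

Lemma dense_approx (D U : set (Cfun R B)) h A (e : R) :
  dense D -> open U -> U h -> bornology_sets B A -> 0 < e ->
  exists2 g, (U `&` D) g & forall x, A x -> `|h x - g x| < e.
Proof.
move=> dD oU Uh BA e0.
pose W : set (Cfun R B) := [set g | forall x, A x -> `|h x - g x| < e].
have hW : nbhs h W by apply/nbhs_CfunP; exists A, e; split.
have [||g [[Ug Wg] Dg]] := dD (U `&` W°).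
- by exists h; split => //; exact: nbhs_interior.
- by apply: openI => //; exact: open_interior.
by exists g => //; exact: interior_subset Wg.
Qed.

Lemma cluster_Cfun (u : nat -> Cfun R B) p A (e : R) (N : nat) :
  cluster (u @ \oo) p -> bornology_sets B A -> 0 < e ->
  exists2 n, (N <= n)%N & forall x, A x -> `|p x - u n x| < e.
Proof.
move=> up BA e0.
have [||_ [[n Nn <-] pu]] :=
  up (u @` [set n | (N <= n)%N])
     [set g : Cfun R B | forall x, A x -> `|p x - g x| < e].
- by exists N => // n /= Nn; exists n.
- by apply/nbhs_CfunP; exists A, e; split.
by exists n.
Qed.

(** The values [u n x] converge to [f x], and infinitely many of them come arbitrarily close to
    [p x]. *)
Lemma cluster_Cfun_eq (u : nat -> Cfun R B) f p (x : X) (N : nat) :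
  cluster (u @ \oo) p ->
  (forall n, (N <= n)%N -> `|f x - u n x| < n.+1%:R^-1) -> p x = f x.
Proof.
move=> up fu; apply/eqP; rewrite -subr_eq0 -normr_le0; apply/ler_addgt0Pr => e e0.
have e20 : 0 < e / 2 by rewrite divr_gt0.
have [M _ Me] := near_infty_natSinv_lt (PosNum e20).
have [n Nn pu] := cluster_Cfun u p [set x] (e / 2) (maxn N M) up (bornology_set1 x) e20.
move: Nn; rewrite geq_max => /andP[/fu fun_ /Me /= Mn].
have {}pu := pu x erefl.
rewrite add0r (splitr e) ltW// (le_lt_trans (ler_distD (u n x) _ _))//.
by rewrite ltrD// distrC (lt_trans fun_).
Qed.

(** Add [c * (1 - k)] to [f], where [k] separates [x] from [E] by complete regularity. *)
Lemma spike f E (x : X) (c : R) :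
  tychonoff_space X -> closed E -> ~ E x ->
  exists h, (forall y, E y -> h y = f y) /\ h x = f x + c.
Proof.
move=> [_ /(completely_regularP R) crX] cE Ex.
have [k [ck _ kx kE]] := crX x E cE Ex.
pose h (y : X) : R := f y + c * (1 - k y).
have ch : continuous h.
  move=> y; apply: cvgD; first exact: (@cts_fun _ _ f).
  apply: cvgMl_tmp => //; apply: cvgB; [exact: cvg_cst|exact: ck].
pose hC : continuousType X R := HB.pack h (isContinuous.Build X R h ch).
exists hC; split=> [y /kE ky|]; rewrite /hC /= /h.
  by rewrite ky subrr mulr0 addr0.
by rewrite kx subr0 mulr1.
Qed.

Lemma qD_point_cofinal (S : set (set X)) (D : set (Cfun R B)) f :
  tychonoff_space X -> closed_bornology_base B S -> dense D -> qD_point D f ->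
  exists2 E : nat -> set X, forall n, bornology_sets B (E n) &
    forall A, bornology_sets B A -> exists n, A `<=` E n.
Proof.
move=> tychX [[SB baseS] clS] dD [U [oU Ucluster]].
(* A basic neighborhood of [f] inside [U n] is given by some [A]; enlarging [A] to a member of the
   base makes it closed. *)
have /choice[K SK] (n : nat) : exists K, [/\ bornology_sets B K, closed K &
    forall g, (forall y, K y -> g y = f y) -> U n g].
  have [oUn Uf] := oU n.
  have /nbhs_CfunP[A [e [BA e0 AU]]] : nbhs f (U n) by exact: open_nbhs_nbhs.
  have [K SK AK] := baseS _ BA; exists K; split; [exact: SB|exact: clS|].
  by move=> g gf; apply: AU => x /AK /gf ->; rewrite subrr normr0.
pose E n := \big[setU/set0]_(k < n.+1) K k.
have BE n : bornology_sets B (E n).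
  rewrite /E; elim: n => [|n ih].
    by rewrite big_ord1; case: (SK 0%N).
  rewrite big_ord_recr; apply: (bornology_setU (bornologyP B)) => //=.
  by case: (SK n.+1).
have clE n : closed (E n) by apply: closed_bigsetU => k _; case: (SK k).
have KE k n : (k <= n)%N -> K k `<=` E n.
  by move=> kn x Kx; rewrite /E -bigcup_mkord; exists k.
have homoE m n : (m <= n)%N -> E m `<=` E n.
  move=> mn x; rewrite {1}/E -bigcup_mkord => -[k /= km Kx].
  by apply: KE Kx; exact: leq_trans mn.
exists E => //; apply: contrapT => /existsNP[A /not_implyP[BA noE]].
have AE n : exists x, A x /\ ~ E n x.
  apply: contrapT => AE; apply: noE; exists n => x Ax.
  by apply: contrapT => Ex; apply: AE; exists x.
(* Either one point of [A] avoids every [E n] and serves for all [n], or the [E n] cover [A]. *)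
have [x [Ax Ex dich]] : exists x : nat -> X, [/\ forall n, A (x n),
    forall n, ~ E n (x n) &
    (forall n, x n = x 0%N) \/ forall y, A y -> exists n, E n y].
  have [[y [Ay Ey]]|AEU] := pselect (exists y, A y /\ forall n, ~ E n y).
    by exists (fun=> y); split => //; left.
  have [x xE] := choice AE.
  exists x; split=> [n|n|]; [by case: (xE n)|by case: (xE n)|right=> y Ay].
  apply: contrapT => nE; apply: AEU; exists y; split => // n Ey.
  by apply: nE; exists n.
have /choice[u uP] (n : nat) : exists g, [/\ (U n `&` D) g,
    forall y, E n y -> `|f y - g y| < n.+1%:R^-1 &
    `|f (x n) + n%:R - g (x n)| < 1].
  have [h [hf hx]] := spike f (E n) (x n) n%:R tychX (clE n) (Ex n).
  have Uh : U n h.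
    by case: (SK n) => _ _; apply => y Ky; apply: hf; exact: KE Ky.
  (* One tolerance serves both purposes: it tends to 0 on the sets [E n] and is at most 1 at
     [x n]. *)
  have [g UDg hg] := dense_approx D (U n) h _ _ dD (oU n).1 Uh
    (bornology_setU (bornologyP B) (BE n) (bornology_set1 (x n)))
    (ltac:(by rewrite invr_gt0) : 0 < n.+1%:R^-1 :> R).
  exists g; split => // [y Ey|]; first by rewrite -hf// hg//; left.
  rewrite -hx (lt_le_trans (hg _ _))//; first by right.
  by rewrite invf_le1// ler1n.
have [|p up] := Ucluster u; first by move=> n; case: (uP n).
have [xcst|EA] := dich.
  (* The two estimates by 1 at [x 0] force [n < p (x 0) - f (x 0) + 2], which the bound on [n]
     excludes. *)
  have [n Nn pu] := cluster_Cfun u p [set x 0%N] 1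
    (Num.bound (p (x 0%N) - f (x 0%N) + 2)) up (bornology_set1 _) ltr01.
  have {}pu := pu _ erefl.
  have [_ _] := uP n; rewrite xcst => fu.
  have := unstable.ltr_bound (p (x 0%N) - f (x 0%N) + 2).
  rewrite -(ler_nat R) in Nn.
  by move: pu fu; rewrite !ltr_norml => /andP[? ?] /andP[? ?]; lra.
have pf y : A y -> p y = f y.
  move=> /EA[m Emy]; apply: (cluster_Cfun_eq u f p y m up) => n mn.
  by have [_ + _] := uP n; apply; exact: homoE Emy.
have [n n2 pu] := cluster_Cfun u p A 1 2 up BA ltr01.
have {}pu := pu _ (Ax n).
have [_ _] := uP n; rewrite -(pf _ (Ax n)).
rewrite -(ler_nat R) in n2.
by move: pu; rewrite !ltr_norml => /andP[? ?] /andP[? ?]; lra.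
Qed.

(** Truncating at [1 / (n + 1)] keeps the supremum finite and makes all but finitely many [E n]
    negligible at a given scale. *)
Lemma metrizable_cofinal (E : nat -> set X) :
  (forall n, bornology_sets B (E n)) ->
  (forall A, bornology_sets B A -> exists n, A `<=` E n) ->
  metrizable R (Cfun R B).
Proof.
move=> BE cofE.
pose G f g := [set r : R | exists n x, E n x /\
  r = Num.min n.+1%:R^-1 `|f x - g x|].
pose d f g := sup (G f g).
have G_ub f g : has_ubound (G f g).
  exists 1 => _ [n [x [_ ->]]]; rewrite ge_min invf_le1// ?ler1n//.
have G_neq0 f g : G f g !=set0.
  have [x Ex] := bornology_nonempty (bornologyP B) (BE 0%N).
  by exists (Num.min 1%:R^-1 `|f x - g x|), 0%N, x.
have le_d f g n x : E n x -> Num.min n.+1%:R^-1 `|f x - g x| <= d f g.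
  by move=> Ex; apply: ub_le_sup => //; exists n, x.
have d_le f g c : (forall n x, E n x -> Num.min n.+1%:R^-1 `|f x - g x| <= c) ->
    d f g <= c.
  by move=> H; apply: ge_sup => // _ [n [x [Ex ->]]]; exact: H.
have d_sym f g : d f g = d g f.
  rewrite /d; congr sup; apply/seteqP; split=> r [n [x [Ex ->]]];
  by exists n, x; rewrite distrC.
exists d; split => //.
- move=> f g; split=> [dfg|<-].
    apply/continuousEP => x.
    have [n xE] := cofE _ (bornology_set1 x).
    have := le_d f g n x (xE _ erefl).
    rewrite dfg ge_min leNgt invr_gt0 ltr0n /= normr_le0 subr_eq0.
    by move/eqP.
  apply/eqP; rewrite eq_le; apply/andP; split.
    by apply: d_le => n x _; rewrite subrr normr0 ge_min lexx orbT.
  have [x Ex] := bornology_nonempty (bornologyP B) (BE 0%N).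
  apply: le_trans (le_d f f 0%N x Ex).
  by rewrite le_min normr_ge0 invr_ge0 ler0n.
- move=> f g h; apply: d_le => n x Ex.
  apply: le_trans (lerD (le_d f g n x Ex) (le_d g h n x Ex)).
  (* Truncation at a positive constant preserves the triangle inequality. *)
  have := ler_distD (g x) (f x) (h x).
  have := normr_ge0 (f x - g x); have := normr_ge0 (g x - h x).
  have : 0 < n.+1%:R^-1 :> R by rewrite invr_gt0.
  move: (n.+1%:R^-1) => c ? ? ? ?.
  rewrite ge_min /Num.min.
  by case: ltP => ?; case: ltP => ?; apply/orP; (left; lra) || (right; lra).
- move=> f W; split=> [/nbhs_CfunP[A [e [BA e0 AW]]]|[e e0 dW]].
    have [n AE] := cofE _ BA.
    (* Below [1 / (n + 1)] the truncation is inactive on [E n]. *)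
    exists (Num.min n.+1%:R^-1 e); first by rewrite lt_min e0 invr_gt0 ltr0n.
    move=> g /= dfg; apply: AW => x /AE Ex.
    have := le_lt_trans (le_d f g n x Ex) dfg.
    rewrite lt_min !gt_min ltxx /= => /andP[fgn /orP[ne|//]].
    exact: lt_trans fgn ne.
  (* Bounding a supremum gives only a weak inequality, hence [e / 2]. *)
  have e20 : 0 < e / 2 by rewrite divr_gt0.
  have [N _ Ne] := near_infty_natSinv_lt (PosNum e20).
  have BU n : bornology_sets B (\big[setU/set0]_(k < n.+1) E k).
    elim: n => [|n ih]; first by rewrite big_ord1.
    by rewrite big_ord_recr; exact: (bornology_setU (bornologyP B)).
  apply/nbhs_CfunP; exists (\big[setU/set0]_(k < N.+1) E k), (e / 2).
  split => // g fg; apply: dW => /=.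
  apply: le_lt_trans (_ : _ <= e / 2) _; last lra.
  apply: d_le => n x Ex; rewrite ge_min.
  have [nN|/ltnW/Ne/ltW ->//] := leqP n N.
  by apply/orP; right; apply/ltW/fg; rewrite -bigcup_mkord; exists n.
Qed.

End uniform_convergence.

(** A sequence taken from balls of radius [1 / (n + 1)] around [x] clusters at [x]. Interiors of
    balls supply open sets directly. *)
Lemma metrizable_qD_point (R : realType) (T : topologicalType) (x : T) :
  metrizable R T -> qD_point setT x.
Proof.
move=> [d [d0 dsym dtri dnbhs]].
pose ball n := [set y | d x y < n.+1%:R^-1 :> R].
exists (fun n => (ball n)°); split=> [n|u uball].
  split; first exact: open_interior.
  by apply/dnbhs; exists n.+1%:R^-1; rewrite // invr_gt0.
exists x => V W [N _ NV] /dnbhs[e e0 eW].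
have [M _ Me] := near_infty_natSinv_lt (PosNum e0).
exists (u (maxn N M)); split; first by apply: NV => /=; exact: leq_maxl.
apply: eW; have [+ _] := uball (maxn N M).
move=> /interior_subset /= ulb; apply: lt_trans ulb _.
by apply: Me => /=; exact: leq_maxr.
Qed.

Local Close Scope ring_scope.

Theorem theorem3p4 (R : realType) (X : topologicalType) (B : bornology X)
    (S : set (set X)) (tychX : tychonoff_space X)
    (closedS : closed_bornology_base B S) :
  metrizable R (Cfun R B) <->
  exists D : set (Cfun R B), dense D /\ exists f : Cfun R B, qD_point D f.
Proof.
split=> [mC|[D [dD [f qf]]]].
  exists setT; split; first by move=> O O0 _; rewrite setIT.
  (* Any function would do; the zero function shows that there is one. *)
  pose z : X -> R := cst 0%R.
  pose zC : continuousType X R :=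
    HB.pack z (isContinuous.Build X R z (@cst_continuous X R 0%R)).
  by exists zC; exact: metrizable_qD_point mC.
have [E BE cofE] := qD_point_cofinal S D f tychX closedS dD qf.
exact: metrizable_cofinal BE cofE.
Qed.
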